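(* Let $\Sigma\in\mathbb{R}^{m\times m}$ be symmetric positive definite, let $D:\mathbb{R}^m\times\mathbb{R}^m\to\mathbb{R}$ be $D(x,y)=\|x-y\|_\Sigma^2$, let $A\in\mathbb{R}^{m\times n}$, and let $f:\mathbb{R}^n\to\mathbb{R}\cup\{\infty\}$ be a convex piecewise linear function. If the solution map $S_{A,f}(b)=\operatorname*{argmin}_{x\in\mathbb{R}^n}\{D(Ax,b)+f(x)\}$ is single-valued (i.e. $S_{A,f}(b)$ has exactly one element for every $b\in\mathbb{R}^m$), then $S_{A,f}$ is continuous as a map $\mathbb{R}^m\to\mathbb{R}^n$.
   Context: $\|v\|_\Sigma^2=v^T\Sigma v$. A function $f:\mathbb{R}^n\to\mathbb{R}\cup\{\infty\}$ is convex piecewise linear if its epigraph $\{(x,t)\in\mathbb{R}^n\times\mathbb{R}: f(x)\le t\}$ is a polyhedral set (an intersection of finitely many closed halfspaces); equivalently $f(x)=\max_{i=1,\dots,k}\{v_i^Tx+w_i\}+\chi_P(x)$ with $P$ polyhedral and $\chi_P$ equal to $0$ on $P$ and $\infty$ elsewhere. Such functions are assumed to be proper (not identically $\infty$). *)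

(* Defs.v *)
From HB Require Import structures.
From mathcomp Require Import all_boot all_order all_algebra.
From mathcomp Require Import all_classical all_reals all_analysis.
Set Implicit Arguments.
Unset Strict Implicit.
Unset Printing Implicit Defensive.
Import Order.TTheory GRing.Theory Num.Theory.
Import numFieldNormedType.Exports.
Local Open Scope classical_set_scope.
Local Open Scope ring_scope.

Definition sqnorm (R : realType) (m : nat) (Sigma : 'M[R]_m) (v : 'cV[R]_m) : R :=
  (v^T *m Sigma *m v) 0 0.

Definition sym_posdef (R : realType) (m : nat) (Sigma : 'M[R]_m) : Prop :=
  Sigma^T = Sigma /\ forall v : 'cV[R]_m, v != 0 -> 0 < (v^T *m Sigma *m v) 0 0.

Definition closed_halfspace (R : realType) (n : nat) (H : set ('cV[R]_n * R)) : Prop :=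
  exists (a : 'cV[R]_n) (c d : R),
    (a, c) != (0, 0) /\ H = [set p | (a^T *m p.1) 0 0 + c * p.2 <= d].

Definition polyhedral (R : realType) (n : nat) (P : set ('cV[R]_n * R)) : Prop :=
  exists (k : nat) (H : 'I_k -> set ('cV[R]_n * R)),
    (forall i, closed_halfspace (H i)) /\ P = \bigcap_(i in [set: 'I_k]) H i.

Definition epigraph (R : realType) (n : nat) (f : 'cV[R]_n -> \bar R) :
    set ('cV[R]_n * R) :=
  [set p | (f p.1 <= p.2%:E)%E].

(* The first clause restricts the values of [f] to the reals and [+oo]; the
   second one is properness. *)
Definition convex_piecewise_linear (R : realType) (n : nat)
    (f : 'cV[R]_n -> \bar R) : Prop :=
  [/\ forall x, f x != -oo%E,
      exists x, f x != +oo%E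
    & polyhedral (epigraph f)].

Definition argmin (R : realType) (T : Type) (g : T -> \bar R) : set T :=
  [set x | forall y, (g x <= g y)%E].

Definition sqdist (R : realType) (m : nat) (Sigma : 'M[R]_m) (x y : 'cV[R]_m) : R :=
  sqnorm Sigma (x - y).

Definition solution_map (R : realType) (m n : nat)
    (D : 'cV[R]_m -> 'cV[R]_m -> R) (A : 'M[R]_(m, n)) (f : 'cV[R]_n -> \bar R)
    (b : 'cV[R]_m) : set 'cV[R]_n :=
  argmin (fun x => ((D (A *m x) b)%:E + f x)%E).

(* Main.v *)
Require Import Defs.
From HB Require Import structures.
From mathcomp Require Import all_boot all_order all_algebra.
From mathcomp Require Import ring lra.
From mathcomp Require Import all_classical all_reals all_analysis.
Set Implicit Arguments.
Unset Strict Implicit.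
Unset Printing Implicit Defensive.
Import Order.TTheory GRing.Theory Num.Theory.
Import numFieldNormedType.Exports.
Local Open Scope classical_set_scope.
Local Open Scope ring_scope.

(* Write F_b = D(A ., b) + f and x0 = s(b0).  Since x0 is the only minimiser of
   F_{b0}, one has F_{b0} > F_{b0}(x0) on the sphere of radius e around x0; as
   the epigraph of f is closed and the sphere compact, F_b > F_b(x0) on that
   sphere for all b near b0.  If s(b) were outside the ball, the segment from
   x0 to s(b) would meet the sphere at a point where, by convexity,
   F_b <= max (F_b(x0), F_b(s(b))) = F_b(x0), a contradiction. *)

Lemma continuous_pair (T U V : topologicalType) (F : T -> U) (G : T -> V) :
  continuous F -> continuous G -> continuous (fun t => (F t, G t)).
Proof.
move=> cF cG t; apply: (@cvg_pair _ _ _ (nbhs t) (nbhs (F t)) (nbhs (G t))).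
  exact: cF.
exact: cG.
Qed.

Lemma continuous_mx (R : realType) (T : topologicalType) (m n : nat)
    (F : T -> 'M[R]_(m, n)) :
  (forall i j, continuous (fun t => F t i j)) -> continuous F.
Proof.
move=> cF t; apply/cvg_mx_entourageP => A entA.
(* Entourages of matrices are entrywise, and there are finitely many entries, so entrywise
   neighbourhoods can be intersected. *)
apply: filter_forall => i; apply: filter_forall => j.
have /cvg_entourageP/(_ _ entA) := cF i j t.
rewrite !near_simpl; apply: filterS => u ?; exact: mem_set.
Qed.

Lemma continuous_coord (R : realType) (T : topologicalType) (m n : nat)
    (F : T -> 'M[R]_(m, n)) i j :
  continuous F -> continuous (fun t => F t i j).
Proof.
move=> cF t.
apply: (@continuous_comp _ _ _ F (fun M : 'M[R]_(m, n) => M i j)).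
  exact: cF.
exact: coord_continuous.
Qed.

Lemma continuous_trmx (R : realType) (T : topologicalType) (m n : nat)
    (F : T -> 'M[R]_(m, n)) :
  continuous F -> continuous (fun t => (F t)^T).
Proof.
move=> cF; apply: continuous_mx => i j.
under eq_fun do rewrite mxE.
exact: continuous_coord.
Qed.

Lemma continuous_mulmx (R : realType) (T : topologicalType) (m n p : nat)
    (F : T -> 'M[R]_(m, n)) (G : T -> 'M[R]_(n, p)) :
  continuous F -> continuous G -> continuous (fun t => F t *m G t).
Proof.
move=> cF cG; apply: continuous_mx => i j.
under eq_fun do rewrite mxE.
apply: (@continuous_big _ _ +%R) => [|k _ t]; first exact: add_continuous.
by apply: continuousM; exact: continuous_coord.
Qed.

Lemma continuous_sqnorm (R : realType) (T : topologicalType) (m : nat)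
    (Sigma : 'M[R]_m) (F : T -> 'cV[R]_m) :
  continuous F -> continuous (fun t => sqnorm Sigma (F t)).
Proof.
move=> cF t; rewrite /sqnorm.
apply: (@continuous_coord _ _ _ _ (fun t => (F t)^T *m Sigma *m F t)).
apply: continuous_mulmx => //; apply: continuous_mulmx.
  exact: continuous_trmx.
by move=> ?; exact: cvg_cst.
Qed.

Lemma closed_polyhedral (R : realType) (n : nat) (P : set ('cV[R]_n * R)) :
  polyhedral P -> closed P.
Proof.
move=> [k [H [hH ->]]]; apply: closed_bigI => i _.
have [a [c [d [_ ->]]]] := hH i.
have ch : continuous (fun p : 'cV[R]_n * R => (a^T *m p.1) 0 0 + c * p.2).
  move=> p; apply: cvgD.
    apply: (@continuous_coord _ _ _ _ (fun p : 'cV[R]_n * R => a^T *m p.1)).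
    by apply: continuous_mulmx => q; [exact: cvg_cst|exact: cvg_fst].
  by apply: cvgM; [exact: cvg_cst|exact: cvg_snd].
exact: (preimage_closed (fun p _ => ch p) (@closed_le R d)).
Qed.

Lemma polyhedral_convex (R : realType) (n : nat) (P : set ('cV[R]_n * R))
    (x y : 'cV[R]_n) (s t l : R) :
  polyhedral P -> 0 <= l <= 1 -> P (x, s) -> P (y, t) ->
  P ((1 - l) *: x + l *: y, (1 - l) * s + l * t).
Proof.
move=> [k [H [hH ->]]] /andP[l0 l1] Px Py i _.
have [a [c [d [_ Hi]]]] := hH i.
move: (Px i I) (Py i I); rewrite Hi /= mulmxDr -!scalemxAr !mxE.
set u := \sum_j _; set v := \sum_j _ => hu hv.
have l'0 : 0 <= 1 - l by rewrite subr_ge0.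
have := ler_wpM2l l'0 hu; have := ler_wpM2l l0 hv; lra.
Qed.

(** The convexity defect is exactly [l * (1 - l) * sqnorm Sigma (u - v)], which is nonnegative. *)
Lemma sqnorm_convex (R : realType) (m : nat) (Sigma : 'M[R]_m)
    (u v : 'cV[R]_m) (l : R) :
  sym_posdef Sigma -> 0 <= l <= 1 ->
  sqnorm Sigma ((1 - l) *: u + l *: v)
    <= (1 - l) * sqnorm Sigma u + l * sqnorm Sigma v.
Proof.
move=> [_ pos] /andP[l0 l1].
have ge0 : 0 <= sqnorm Sigma (u - v).
  have [->|/pos/ltW//] := eqVneq (u - v) 0.
  by rewrite /sqnorm mulmx0 mxE.
suff -> : sqnorm Sigma ((1 - l) *: u + l *: v) =
    (1 - l) * sqnorm Sigma u + l * sqnorm Sigma v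
    - l * (1 - l) * sqnorm Sigma (u - v).
  by rewrite gerBl mulr_ge0// mulr_ge0// subr_ge0.
have trD (a b : 'cV[R]_m) : (a + b)^T = a^T + b^T by exact: raddfD.
have trN (a : 'cV[R]_m) : (- a)^T = - a^T by exact: raddfN.
have trZ k (a : 'cV[R]_m) : (k *: a)^T = k *: a^T by exact: linearZ.
rewrite /sqnorm !(trD, trN, trZ) !(mulmxDr, mulmxN, =^~ scalemxAr).
rewrite !(mulmxDl, mulNmx, =^~ scalemxAl).
move: (u^T *m Sigma *m u) (u^T *m Sigma *m v) (v^T *m Sigma *m u)
  (v^T *m Sigma *m v) => p q r w.
rewrite !mxE; ring.
Qed.

Lemma mx_norm_trmx (R : realType) (m n : nat) (M : 'M[R]_(m, n)) :
  `|M^T| = `|M|.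
Proof.
have le p q (N : 'M[R]_(p, q)) : `|N^T| <= `|N|.
  rewrite [leLHS]mx_normrE; apply/bigmax_leP; split=> [//|[i j] _ /=].
  rewrite mxE [leRHS]mx_normrE.
  exact: (le_bigmax _ (fun ij => `|N ij.1 ij.2|) (j, i)).
by apply/le_anti; rewrite le -{1}[M]trmxK le.
Qed.

(** [bounded_closed_compact] concerns row vectors, so the sphere is written as the image under
    transposition of a closed bounded set of rows. *)
Lemma compact_sphere (R : realType) (n : nat) (x : 'cV[R]_n) (e : R) :
  compact [set y : 'cV[R]_n | `|y - x| = e].
Proof.
have continuous_trmx_id : continuous (fun v : 'rV[R]_n => v^T).
  by apply: (@continuous_trmx _ _ _ _ idfun) => w; exact: cvg_id.
have cN : continuous (fun v : 'rV[R]_n => `|v^T - x|).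
  have cB : continuous (fun v : 'rV[R]_n => v^T - x).
    move=> v; apply: (@continuousB _ _ _ (fun v : 'rV[R]_n => v^T) (fun=> x)).
      exact: continuous_trmx_id.
    exact: cst_continuous.
  move=> v; apply: continuous_comp; first exact: cB.
  exact: norm_continuous.
suff cS : compact [set v : 'rV[R]_n | `|v^T - x| = e].
  have -> : [set y | `|y - x| = e] = trmx @` [set v : 'rV[R]_n | `|v^T - x| = e].
    apply/seteqP; split=> [y /= hy|_ [v hv <-]//].
    by exists y^T; rewrite /= trmxK.
  apply: continuous_compact => //; apply: continuous_subspaceT.
  exact: continuous_trmx_id.
apply: bounded_closed_compact.
  exists (e + `|x|); split=> [|M hM v /= ve]; first exact: num_real.
  apply: le_trans (ltW hM); rewrite -ve -(mx_norm_trmx v).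
  by have := ler_normD (v^T - x) x; rewrite subrK.
exact: (@preimage_closed _ _ _ [set e] (fun v _ => cN v) (@closed_eq _ e)).
Qed.

(** The topological core: polyhedrality will supply the closed convex epigraph, and the quadratic
    term the joint continuity and convexity of [Phi]. *)
Lemma continuous_unique_argmin (R : realType) (T : topologicalType) (n : nat)
    (f : 'cV[R]_n -> \bar R) (Phi : T -> 'cV[R]_n -> R) (s : T -> 'cV[R]_n) :
  (forall x, f x != -oo%E) -> (exists x, f x != +oo%E) ->
  closed (epigraph f) ->
  (forall x y t u l, 0 <= l <= 1 -> epigraph f (x, t) -> epigraph f (y, u) ->
    epigraph f ((1 - l) *: x + l *: y, (1 - l) * t + l * u)) ->
  continuous (fun p : T * 'cV[R]_n => Phi p.1 p.2) ->
  (forall b x y l, 0 <= l <= 1 ->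
    Phi b ((1 - l) *: x + l *: y) <= (1 - l) * Phi b x + l * Phi b y) ->
  (forall b, argmin (fun x => ((Phi b x)%:E + f x)%E) = [set s b]) ->
  continuous s.
Proof.
move=> fNy [z fz] cE convE cPhi convPhi hs b0.
have smin b y : ((Phi b (s b))%:E + f (s b) <= (Phi b y)%:E + f y)%E.
  have : argmin (fun x => ((Phi b x)%:E + f x)%E) (s b) by rewrite hs.
  exact.
(* A minimiser is no worse than [z], where the objective is finite. *)
have f_fin b : exists t, f (s b) = t%:E.
  move: (smin b z) (fNy (s b)) fz (fNy z).
  by case: (f (s b)) => [t| |] //; [exists t|case: (f z)].
set x0 := s b0; have [t0 ft0] := f_fin b0; rewrite -/x0 in ft0.
(* Since [f x0 = t0], lying outside the epigraph here means F_b(y) > F_b(x0). In this form the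
   condition is open in (y, b), although [f] itself need not be continuous. *)
have sphere_gt e : 0 < e -> \forall b \near b0, forall y, `|y - x0| = e ->
    ~ epigraph f (y, t0 + Phi b x0 - Phi b y).
  move=> e0.
  (* Compactness turns the neighbourhoods of [b0] found around each [y] of the sphere into a single
     one. *)
  have /compact_near_coveringP cS := @compact_sphere R n x0 e.
  apply: (cS T (nbhs b0)
    (fun b y => ~ epigraph f (y, t0 + Phi b x0 - Phi b y))) => y ye.
  pose g (p : 'cV[R]_n * T) := (p.1, t0 + Phi p.2 x0 - Phi p.2 p.1).
  have cg : continuous g.
    have c2 (F : 'cV[R]_n * T -> 'cV[R]_n) : continuous F ->
        continuous (fun p => Phi p.2 (F p)).
      move=> cF p.
      apply: (@continuous_comp _ _ _ (fun p => (p.2, F p))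
        (fun p => Phi p.1 p.2)); last exact: cPhi.
      by apply: continuous_pair => // q; exact: cvg_snd.
    apply: continuous_pair => p; first exact: cvg_fst.
    apply: cvgB; last by apply: c2 => q; exact: cvg_fst.
    apply: cvgD; first exact: cvg_cst.
    by apply: (c2 (fun=> x0)); exact: cst_continuous.
  (* Otherwise [y] would also minimise F_{b0}, hence equal [x0], whereas its distance to [x0] is
     [e > 0]. *)
  have Ey : ~ epigraph f (g (y, b0)).
    rewrite /epigraph /= => fy.
    suff : y = x0 by move=> yx; move: e0; rewrite -ye yx subrr normr0 ltxx.
    have : [set s b0] y; last by [].
    rewrite -hs => w; apply: le_trans (smin b0 w).
    rewrite -/x0 ft0 (le_trans (leeD2l _ fy))// -!EFinD lee_fin.
    lra.
  have := closed_openC cE; rewrite openE => /(_ _ Ey) nE.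
  exact: cg nE.
apply/cvgrPdist_lt => e e0.
near=> b; rewrite distrC ltNge; apply/negP => le_e.
have nb : forall y, `|y - x0| = e -> ~ epigraph f (y, t0 + Phi b x0 - Phi b y).
  by near: b; exact: sphere_gt.
have [t1 ft1] := f_fin b.
(* The ratio that puts the point [y] of the segment at distance exactly [e] from [x0]; it is at most
   1 because [s b] is assumed at distance at least [e]. *)
pose l := e / `|s b - x0|.
have d0 : 0 < `|s b - x0| by exact: lt_le_trans le_e.
have l01 : 0 <= l <= 1.
  by rewrite /l ler_pdivrMr// mul1r le_e divr_ge0// ltW.
have [l0 _] := andP l01.
pose y := (1 - l) *: x0 + l *: s b.
have ye : `|y - x0| = e.
  have -> : y - x0 = l *: (s b - x0).
    by rewrite /y scalerBl scale1r scalerBr addrAC [x0 - _]addrC addrK addrC.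
  by rewrite normrZ ger0_norm ?l0// divfK// gt_eqF.
apply: (nb y ye).
(* Three inequalities add up: convexity of [f], convexity of [Phi b], and [l] times F_b(s b) <=
   F_b(x0). *)
have /convE : 0 <= l <= 1 by [].
move=> /(_ x0 (s b) t0 t1); rewrite /epigraph /= ft0 ft1 !lexx.
move=> /(_ isT isT) h; apply: le_trans h _; rewrite lee_fin.
have := smin b x0; rewrite ft0 ft1 -!EFinD lee_fin => /(ler_wpM2l l0).
have := convPhi b x0 (s b) l l01; rewrite -/y.
lra.
Unshelve. all: by end_near. Qed.

Theorem theorem3p3 (R : realType) (m n : nat) (Sigma : 'M[R]_m)
    (A : 'M[R]_(m, n)) (f : 'cV[R]_n -> \bar R)
    (hSigma : sym_posdef Sigma)
    (hf : convex_piecewise_linear f)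
    (hS : forall b : 'cV[R]_m,
      exists! x : 'cV[R]_n, solution_map (sqdist Sigma) A f b x) :
  exists s : 'cV[R]_m -> 'cV[R]_n,
    (forall b : 'cV[R]_m, solution_map (sqdist Sigma) A f b = [set s b]) /\
    continuous s.
Proof.
have [s hs] := choice hS; exists s.
have sE b : solution_map (sqdist Sigma) A f b = [set s b].
  by have [sb sU] := hs b; apply/seteqP; split=> [x /sU <-//|x ->].
split=> //; have [fNy fy polyf] := hf.
apply: (continuous_unique_argmin fNy fy _ _ _ _ sE).
- exact: closed_polyhedral.
- by move=> x y t u l l01; exact: polyhedral_convex.
- apply: continuous_sqnorm => p; apply: cvgB; last exact: cvg_fst.
  by apply: continuous_mulmx => q; [exact: cvg_cst|exact: cvg_snd].
- move=> b x y l l01; rewrite /sqdist.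
  (* The residual is affine in the point and the weights sum to 1, so it commutes with convex
     combinations. *)
  suff -> : A *m ((1 - l) *: x + l *: y) - b =
      (1 - l) *: (A *m x - b) + l *: (A *m y - b) by exact: sqnorm_convex.
  rewrite mulmxDr -!scalemxAr !scalerBr addrACA -opprD -scalerDl subrK.
  by rewrite scale1r.
Qed.
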